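(* Let $k$ be a commutative ring, let $(E,R)$ be a finite poset and let $T$ be any finite lattice such that $(E,R)=\mathrm{Irr}(T)$. Let $X$ be a finite set and let $\mathcal{B}_X$ be the set of all maps $\varphi:X\to T$ such that $E\subseteq\varphi(X)\subseteq G$, where $G=G(T)$. Then: (a) The set $\Theta_{T,X}(\mathcal{B}_X)$ (more precisely, the injective image of $\mathcal{B}_X$ under the map $\Theta_{T,X}:F_T(X)\to\mathbb{S}_{E,R^{op}}(X)$) is a $k$-basis of $\mathbb{S}_{E,R^{op}}(X)$. (b) The $k$-module $\mathbb{S}_{E,R^{op}}(X)$ is free of rank $$\mathrm{rk}_k\big(\mathbb{S}_{E,R^{op}}(X)\big)=|\mathcal{B}_X|=\sum_{i=0}^{|E|}(-1)^i\binom{|E|}{i}(|G|-i)^{|X|}.$$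
   Context: **Lattices.** Let $T$ be a finite lattice with order $\leq$, join $\vee$, meet $\wedge$, least element $\hat0$, greatest element $\hat1$. An element $e\in T$ is irreducible if $e=\bigvee_{a\in A}a$ with $A\subseteq T$ implies $e\in A$ (so $\hat0$, the empty join, is not irreducible). $\mathrm{Irr}(T)=(E,R)$ denotes the set $E$ of irreducible elements with the order $R$ induced from $T$; $(a,b)\in R$ means $a\leq b$; $R^{op}$ is the opposite order. For $t\in T$: $r(t)$ is the join of all elements strictly smaller than $t$, and $r^\infty(t)$ is the stable value of the iterates $r^n(t)$; $\sigma(t)$ is the meet of all irreducible elements strictly larger than $t$ (empty meet $=\hat1$), and $\sigma^\infty(t)$ is the stable value of the iterates $\sigma^n(t)$. $\Lambda E$ is the set of all meets of (possibly empty) families of elements of $E$. $\widehat G$ is the set of $t\in T$ such that $t\notin\Lambda E$ and there is $e\in E$ with $t=r^\infty(e)$ and $\sigma(e)=e$. $G=G(T)=\Lambda E\sqcup\widehat G$ (equivalently $G=E\sqcup\{a\in T\mid a=r^\infty(\sigma^\infty(a))\}$). **Correspondences.** For finite sets $X,Y$, $\mathcal{C}(Y,X)$ is the set of all subsets of $Y\times X$; composition of $S\subseteq Z\times Y$ and $Q\subseteq Y\times X$ is $SQ=\{(z,x)\mid\exists y\in Y,\ (z,y)\in S,\ (y,x)\in Q\}$. $k\mathcal{C}(Y,X)$ is the free $k$-module on $\mathcal{C}(Y,X)$, with bilinear composition; $k\mathcal{C}(E,E)$ is a $k$-algebra. $\Delta_E=\{(e,e)\mid e\in E\}$ and, for a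 permutation $\alpha$ of $E$, $\Delta_\alpha=\{(\alpha(e),e)\mid e\in E\}$. A correspondence functor is a $k$-linear functor from the category with objects the finite sets and morphisms $X\to Y$ the elements of $k\mathcal{C}(Y,X)$, to $k$-modules. **Fundamental functors.** For a finite poset $(E,R)$, the fundamental module $\mathcal{P}_Ef_R$ is the left $k\mathcal{C}(E,E)$-module which is $k$-free with basis $\{\Delta_\alpha f_R\}$, $\alpha$ running over the permutations of $E$ ($f_R:=\Delta_{\mathrm{id}}f_R$), where a relation $Q\in\mathcal{C}(E,E)$ acts by $Q\cdot\Delta_\alpha f_R=\Delta_{\beta\alpha}f_R$ if there is a (necessarily unique) permutation $\beta$ with $\Delta_E\subseteq\Delta_{\beta^{-1}}Q\subseteq{}^{\alpha}R:=\{(\alpha(e),\alpha(f))\mid(e,f)\in R\}$, and $Q\cdot\Delta_\alpha f_R=0$ otherwise. For a left $k\mathcal{C}(E,E)$-module $W$, $L_{E,W}(X)=k\mathcal{C}(X,E)\otimes_{k\mathcal{C}(E,E)}W$ and $J_{E,W}(X)=\{\sum_i\varphi_i\otimes w_i\in L_{E,W}(X)\mid\forall\rho\in k\mathcal{C}(E,X),\ \sum_i(\rho\varphi_i)\cdot w_i=0\}$; these are correspondence functors via left composition. The fundamental functor is $\mathbb{S}_{E,R}=L_{E,\mathcal{P}_Ef_R}/J_{E,\mathcal{P}_Ef_R}$. **The map $\Theta$.** $F_T(X)$ is the free $k$-module on the set $T^X$ of all maps $X\to T$. For $\varphi:X\to T$ let $\Gamma_\varphi=\{(x,e)\in X\times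 E\mid e\leq\varphi(x)\}$. The $k$-linear (surjective) map $\Theta_{T,X}:F_T(X)\to\mathbb{S}_{E,R^{op}}(X)$ sends $\varphi$ to the class of $\Gamma_\varphi\otimes f_{R^{op}}$. *)

(* Defs.v *)
From HB Require Import structures.
From mathcomp Require Import all_boot all_order all_algebra all_fingroup.
From mathcomp Require Import boolp freeg.

Set Implicit Arguments.
Unset Strict Implicit.
Unset Printing Implicit Defensive.

Import Order.TTheory GRing.Theory.

Local Open Scope ring_scope.

(** Free k-modules are [{freeg K / k}], with basis the [<<x>>], [x : K];
    [fglift f] is the k-linear map sending [<<x>>] to [f x]. *)

Section FreeModule.
Context (k : comNzRingType).

Section Lift.
Context (K : choiceType) (M : lmodType k).
Implicit Types (f g : K -> M) (D : {freeg K / k}).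

Lemma fgliftU f x : fglift f << x >> = f x.
Proof. by rewrite liftU scale1r. Qed.

Lemma freegU_scale c (x : K) : << c *g x >> = c *: << x >> :> {freeg K / k}.
Proof. by apply/eqP/freeg_eqP => y; rewrite coeffZ !coeffU mul1r. Qed.

Lemma freeg_basisE D : D = \sum_(z <- dom D) coeff z D *: << z >>.
Proof.
by rewrite -[LHS]freeg_sumE; apply: eq_bigr => z _; rewrite freegU_scale.
Qed.

Lemma freeg_lin_ind (P : {freeg K / k} -> Prop) :
    P 0 -> (forall c x D, P D -> P (c *: << x >> + D)) -> forall D, P D.
Proof.
move=> P0 PD D; rewrite [D]freeg_basisE.
by elim: (dom D) => [|z s IHs]; rewrite ?big_nil ?big_cons //; apply: PD.
Qed.

Lemma fglift_additive f : {morph fglift f : D1 D2 / D1 - D2}.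
Proof. exact: lift_is_additive. Qed.

Lemma fglift0 f : fglift f 0 = 0.
Proof. by rewrite -[X in fglift f X](subrr 0) fglift_additive subrr. Qed.

Lemma fgliftD f : {morph fglift f : D1 D2 / D1 + D2}.
Proof.
move=> D1 D2; rewrite -[D2 in LHS]opprK fglift_additive.
by rewrite -[- D2]sub0r fglift_additive fglift0 sub0r opprK.
Qed.

Lemma fgliftZU f c x : fglift f (c *: << x >>) = c *: f x.
Proof. by rewrite -freegU_scale liftU. Qed.

Lemma fglift_scalable f : scalable (fglift f).
Proof.
move=> c; elim/freeg_lin_ind => [|d x D IH]; first by rewrite !(fglift0,scaler0).
by rewrite scalerDr scalerA !fgliftD IH !fgliftZU scalerDr scalerA.
Qed.

Lemma fglift_linear f : linear (fglift f).
Proof. by move=> c D1 D2; rewrite fgliftD fglift_scalable. Qed.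

HB.instance Definition _ f :=
  GRing.isLinear.Build k {freeg K / k} M *:%R (fglift f) (fglift_linear f).

Lemma fglift_linearl c f g D :
  fglift (fun x => c *: f x + g x) D = c *: fglift f D + fglift g D.
Proof.
elim/freeg_lin_ind: D => [|d x D IH]; first by rewrite !fglift0 scaler0 add0r.
rewrite !fgliftD IH !fgliftZU !scalerDr !scalerA mulrC.
by rewrite -!addrA; congr (_ + _); rewrite addrCA.
Qed.

Lemma eq_fglift f g D : f =1 g -> fglift f D = fglift g D.
Proof.
move=> fg; elim/freeg_lin_ind: D => [|d x D IH]; first by rewrite !fglift0.
by rewrite !fgliftD IH !fgliftZU fg.
Qed.

End Lift.

Section Bilift.
Context (K1 K2 : choiceType) (M : lmodType k) (f : K1 -> K2 -> M).

Definition fglift2 (a : {freeg K1 / k}) (b : {freeg K2 / k}) : M :=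
  fglift (fun x => fglift (f x) b) a.

Lemma fglift2UU x y : fglift2 << x >> << y >> = f x y.
Proof. by rewrite /fglift2 !fgliftU. Qed.

Lemma fglift2_linl b : linear (fglift2^~ b).
Proof. exact: fglift_linear. Qed.

Lemma fglift2_linr a : linear (fglift2 a).
Proof.
move=> c b1 b2; rewrite /fglift2 -fglift_linearl.
by apply: eq_fglift => x; rewrite fglift_linear.
Qed.

HB.instance Definition _ a :=
  GRing.isLinear.Build k {freeg K2 / k} M *:%R (fglift2 a) (fglift2_linr a).

Lemma fglift20l b : fglift2 0 b = 0. Proof. exact: fglift0. Qed.

Lemma fglift20r a : fglift2 a 0 = 0. Proof. exact: linear0. Qed.

Lemma fglift2Dl a1 a2 b : fglift2 (a1 + a2) b = fglift2 a1 b + fglift2 a2 b.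
Proof. exact: fgliftD. Qed.

Lemma fglift2Dr a b1 b2 : fglift2 a (b1 + b2) = fglift2 a b1 + fglift2 a b2.
Proof. exact: linearD. Qed.

Lemma fglift2Zl c a b : fglift2 (c *: a) b = c *: fglift2 a b.
Proof. exact: fglift_scalable. Qed.

Lemma fglift2Zr c a b : fglift2 a (c *: b) = c *: fglift2 a b.
Proof. exact: linearZ. Qed.

End Bilift.

Definition fglift2E :=
  (fglift20l, fglift20r, fglift2Dl, fglift2Dr, fglift2Zl, fglift2Zr, fglift2UU).

End FreeModule.

(** [b] restricted to the subset [B] of its index type is a k-basis of [V]. *)
Definition is_basis (k : comNzRingType) (V : lmodType k) (I : finType)
    (B : {set I}) (b : I -> V) : Prop :=
  (forall v : V, exists c : I -> k, v = \sum_(i in B) c i *: b i) /\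
  (forall c : I -> k, \sum_(i in B) c i *: b i = 0 ->
     forall i, i \in B -> c i = 0).

Definition free_of_rank (k : comNzRingType) (V : lmodType k) (n : nat) : Prop :=
  exists b : 'I_n -> V, is_basis [set: 'I_n] b.

Section QuotientModule.
Local Open Scope quotient_scope.
Context (k : comNzRingType) (V : lmodType k) (I : submodClosed V).

Definition submod_pred : {pred V} := fun v => v \in I.

HB.instance Definition _ := GRing.isZmodClosed.Build V submod_pred
  (GRing.submod_closedB (GRing.submodClosedP I)).

Definition quotmod := @Quotient.quot V submod_pred.

HB.instance Definition _ := GRing.Zmodule.on quotmod.
HB.instance Definition _ := EqQuotient.on quotmod.

Definition quotmod_pi (v : V) : quotmod := \pi_quotmod v.

Definition quotmod_scale (c : k) (q : quotmod) : quotmod :=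
  quotmod_pi (c *: generic_quotient.repr q).

Lemma quotmod_eqP u v : (quotmod_pi u == quotmod_pi v) = (u - v \in I).
Proof. by rewrite -[RHS]/(u - v \in submod_pred) Quotient.idealrBE. Qed.

Lemma quotmod_piD : {morph quotmod_pi : u v / u + v}.
Proof. by move=> u v; rewrite /quotmod_pi !piE. Qed.

Lemma quotmod_reprK (q : quotmod) : quotmod_pi (generic_quotient.repr q) = q.
Proof. exact: reprK. Qed.

Lemma quotmod_piZ c v : quotmod_pi (c *: v) = quotmod_scale c (quotmod_pi v).
Proof.
apply/eqP; rewrite quotmod_eqP -scalerBr; apply: rpredZ.
by rewrite -quotmod_eqP quotmod_reprK.
Qed.

Fact quotmod_scalerA c d q :
  quotmod_scale c (quotmod_scale d q) = quotmod_scale (c * d) q.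
Proof. by rewrite -[q]quotmod_reprK -!quotmod_piZ scalerA. Qed.

Fact quotmod_scale1r : left_id 1 quotmod_scale.
Proof. by move=> q; rewrite -[q]quotmod_reprK -quotmod_piZ scale1r. Qed.

Fact quotmod_scalerDr : right_distributive quotmod_scale +%R.
Proof.
move=> c p q; rewrite -[p]quotmod_reprK -[q]quotmod_reprK.
by rewrite -quotmod_piD -!quotmod_piZ scalerDr quotmod_piD.
Qed.

Fact quotmod_scalerDl q : {morph quotmod_scale^~ q : c d / c + d}.
Proof.
move=> c d; rewrite -[q]quotmod_reprK -!quotmod_piZ -quotmod_piD.
by rewrite scalerDl.
Qed.

HB.instance Definition _ := GRing.Zmodule_isLmodule.Build k quotmod
  quotmod_scalerA quotmod_scale1r quotmod_scalerDr quotmod_scalerDl.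

Lemma quotmod_pi_linear : linear quotmod_pi.
Proof. by move=> c u v; rewrite quotmod_piD quotmod_piZ. Qed.

HB.instance Definition _ :=
  GRing.isLinear.Build k V quotmod *:%R quotmod_pi quotmod_pi_linear.

End QuotientModule.

Section Span.
Context (k : comNzRingType) (V : lmodType k) (S : V -> Prop).

Definition span_pred : {pred V} := fun v =>
  `[< exists s : seq (k * V), (forall p, p \in s -> S p.2)
        /\ v = \sum_(p <- s) p.1 *: p.2 >].

Lemma span_pred_closed : submod_closed span_pred.
Proof.
split; first by apply/asboolP; exists [::]; rewrite big_nil.
move=> c _ _ /asboolP[s [sS ->]] /asboolP[t [tS ->]]; apply/asboolP.
exists ([seq (c * p.1, p.2) | p <- s] ++ t); split.
  move=> p; rewrite mem_cat => /orP[/mapP[q qs ->]|]; last exact: (tS p).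
  by move: (sS q qs).
rewrite big_cat big_map scaler_sumr; congr (_ + _).
by apply: eq_bigr => p _; rewrite scalerA.
Qed.

HB.instance Definition _ :=
  GRing.isSubmodClosed.Build k V span_pred span_pred_closed.

End Span.

Section Correspondence.

Definition corr_comp (Z Y X : finType) (S : {set Z * Y}) (Q : {set Y * X}) :
    {set Z * X} :=
  [set p | [exists y, ((p.1, y) \in S) && ((y, p.2) \in Q)]].

Definition diag (E : finType) : {set E * E} := [set p | p.1 == p.2].

Definition perm_corr (E : finType) (a : {perm E}) : {set E * E} :=
  [set (a e, e) | e in E].

Definition conj_corr (E : finType) (a : {perm E}) (R : {set E * E}) :
    {set E * E} :=
  [set (a p.1, a p.2) | p in R].

Lemma corr_compP (Z Y X : finType) (S : {set Z * Y}) (Q : {set Y * X}) z x :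
  reflect (exists2 y, (z, y) \in S & (y, x) \in Q) ((z, x) \in corr_comp S Q).
Proof.
rewrite inE; apply: (iffP existsP) => [[y /andP[]]|[y]]; first by exists y.
by move=> zy yx; exists y; apply/andP.
Qed.

Lemma corr_compA (U Z Y X : finType) (P : {set U * Z}) (S : {set Z * Y})
    (Q : {set Y * X}) :
  corr_comp P (corr_comp S Q) = corr_comp (corr_comp P S) Q.
Proof.
apply/setP => -[u x]; apply/corr_compP/corr_compP => [[z uz /corr_compP[y]]|].
  by move=> zy yx; exists y => //; apply/corr_compP; exists z.
by move=> [y /corr_compP[z uz zy] yx]; exists z => //; apply/corr_compP; exists y.
Qed.

Lemma in_diag (E : finType) (x y : E) : ((x, y) \in diag E) = (x == y).
Proof. by rewrite inE. Qed.

Lemma corr_comp1l (Y X : finType) (Q : {set Y * X}) : corr_comp (diag Y) Q = Q.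
Proof.
apply/setP => -[y x]; apply/corr_compP/idP => [[z]|yx].
  by rewrite in_diag => /eqP->.
by exists y; rewrite ?in_diag.
Qed.

Lemma corr_comp1r (Y X : finType) (Q : {set Y * X}) : corr_comp Q (diag X) = Q.
Proof.
apply/setP => -[y x]; apply/corr_compP/idP => [[z]|yx].
  by rewrite in_diag => yz /eqP<-.
by exists x; rewrite ?in_diag.
Qed.

Lemma perm_corr_compE (E : finType) (a : {perm E}) (Q : {set E * E}) x y :
  ((x, y) \in corr_comp (perm_corr a^-1) Q) = ((a x, y) \in Q).
Proof.
apply/corr_compP/idP => [[z /imsetP[e _ [-> ->]]]|Qxy]; first by rewrite permKV.
by exists (a x) => //; apply/imsetP; exists (a x); rewrite ?permK.
Qed.

Lemma conj_corrE (E : finType) (a : {perm E}) (R : {set E * E}) x y :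
  ((x, y) \in conj_corr a R) = (((a^-1)%g x, (a^-1)%g y) \in R).
Proof.
apply/imsetP/idP => [[[u v] uv [-> ->]]|xy]; first by rewrite !permK.
by exists ((a^-1)%g x, (a^-1)%g y); rewrite //= !permKV.
Qed.

End Correspondence.

(** [kcorr k Y X] is kC(Y,X), the module of morphisms from [X] to [Y]. *)
Definition kcorr (k : comNzRingType) (Y X : finType) := {freeg {set Y * X} / k}.

HB.instance Definition _ k Y X := GRing.Lmodule.on (@kcorr k Y X).

Section KCorr.
Context (k : comNzRingType).

Definition kcomp (Z Y X : finType) (a : kcorr k Z Y) (b : kcorr k Y X) :
    kcorr k Z X :=
  fglift2 (fun S Q => << corr_comp S Q >> : {freeg {set Z * X} / k}) a b.

Lemma kcompA (U Z Y X : finType) (a : kcorr k U Z) (b : kcorr k Z Y)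
    (c : kcorr k Y X) :
  kcomp a (kcomp b c) = kcomp (kcomp a b) c.
Proof.
rewrite /kcomp; elim/freeg_lin_ind: a => [|x P a IHa]; first by rewrite !fglift2E.
rewrite !fglift2E {}IHa; congr (_ *: _ + _).
elim/freeg_lin_ind: b => [|y S b IHb]; first by rewrite !fglift2E.
rewrite !fglift2E {}IHb; congr (_ *: _ + _).
elim/freeg_lin_ind: c => [|z Q c IHc]; first by rewrite !fglift2E.
by rewrite !fglift2E {}IHc corr_compA.
Qed.

Lemma kcomp1l (Y X : finType) (b : kcorr k Y X) : kcomp << diag Y >> b = b.
Proof.
rewrite /kcomp; elim/freeg_lin_ind: b => [|y S b IHb]; first by rewrite !fglift2E.
by rewrite !fglift2E IHb corr_comp1l.
Qed.

Lemma kcomp1r (Y X : finType) (b : kcorr k Y X) : kcomp b << diag X >> = b.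
Proof.
rewrite /kcomp; elim/freeg_lin_ind: b => [|y S b IHb]; first by rewrite !fglift2E.
by rewrite !fglift2E IHb corr_comp1r.
Qed.

End KCorr.

Definition kcorr_alg (k : comNzRingType) (E : finType) := kcorr k E E.

Section KCorrAlgebra.
Context (k : comNzRingType) (E : finType).

HB.instance Definition _ := GRing.Lmodule.on (kcorr_alg k E).

Let mul (a b : kcorr_alg k E) : kcorr_alg k E := kcomp a b.
Let one : kcorr_alg k E := << diag E >>.

Fact kcorr_alg_mulA : associative mul. Proof. exact: kcompA. Qed.
Fact kcorr_alg_mul1l : left_id one mul. Proof. exact: kcomp1l. Qed.
Fact kcorr_alg_mul1r : right_id one mul. Proof. exact: kcomp1r. Qed.
Fact kcorr_alg_mulDl : left_distributive mul +%R.
Proof. by move=> a b c; apply: fglift2Dl. Qed.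
Fact kcorr_alg_mulDr : right_distributive mul +%R.
Proof. by move=> a b c; apply: fglift2Dr. Qed.
Fact kcorr_alg_oner_neq0 : one != 0.
Proof. by rewrite freegU_eq0 oner_eq0. Qed.

HB.instance Definition _ := GRing.Zmodule_isNzRing.Build (kcorr_alg k E)
  kcorr_alg_mulA kcorr_alg_mul1l kcorr_alg_mul1r kcorr_alg_mulDl kcorr_alg_mulDr
  kcorr_alg_oner_neq0.

Fact kcorr_alg_scalerAl (c : k) (a b : kcorr_alg k E) :
  c *: (a * b) = (c *: a) * b.
Proof. by symmetry; apply: fglift2Zl. Qed.
Fact kcorr_alg_scalerAr (c : k) (a b : kcorr_alg k E) :
  c *: (a * b) = a * (c *: b).
Proof. by symmetry; apply: fglift2Zr. Qed.

HB.instance Definition _ := GRing.Lmodule_isLalgebra.Build k (kcorr_alg k E)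
  kcorr_alg_scalerAl.
HB.instance Definition _ := GRing.Lalgebra_isAlgebra.Build k (kcorr_alg k E)
  kcorr_alg_scalerAr.

End KCorrAlgebra.

(** [Lfun W X] and [Jpred] are L_{E,W}(X) and its submodule J_{E,W}(X). The
    tensor product over kC(E,E) is the free k-module on kC(X,E) x W modulo the
    k-submodule generated by the usual relations; k acts through the left
    factor. *)

Section LJ.
Context (k : comNzRingType) (E : finType) (W : lmodType (kcorr_alg k E)).
Context (X : finType).

Inductive tensor_rel : {freeg (kcorr k X E * W) / k} -> Prop :=
| TensorDl (f g : kcorr k X E) (w : W) :
    tensor_rel (<< (f + g, w) >> - << (f, w) >> - << (g, w) >>)
| TensorDr (f : kcorr k X E) (v w : W) :
    tensor_rel (<< (f, v + w) >> - << (f, v) >> - << (f, w) >>)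
| TensorZ (c : k) (f : kcorr k X E) (w : W) :
    tensor_rel (<< (c *: f, w) >> - c *: << (f, w) >>)
| TensorA (f : kcorr k X E) (a : kcorr_alg k E) (w : W) :
    tensor_rel (<< (kcomp f a, w) >> - << (f, a *: w) >>).

Definition Lfun : lmodType k := quotmod (span_pred tensor_rel).

Definition tens (f : kcorr k X E) (w : W) : Lfun := quotmod_pi _ << (f, w) >>.

Lemma tensZl c f w : tens (c *: f) w = c *: tens f w.
Proof.
rewrite -linearZ; apply/eqP; rewrite quotmod_eqP; apply/asboolP.
exists [:: (1, << (c *: f, w) >> - c *: << (f, w) >>)]; split=> [p|].
  by rewrite inE => /eqP->; apply: TensorZ.
by rewrite big_seq1 scale1r.
Qed.

Definition Jpred : {pred Lfun} := fun t =>
  `[< exists s : seq (kcorr k X E * W), t = \sum_(p <- s) tens p.1 p.2 /\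
        forall rho : kcorr k E X,
          \sum_(p <- s) (kcomp rho p.1 : kcorr_alg k E) *: p.2 = 0 >].

Lemma Jpred_closed : submod_closed Jpred.
Proof.
split; first by apply/asboolP; exists [::]; split=> [|?]; rewrite big_nil.
move=> c _ _ /asboolP[s [-> s0]] /asboolP[t [-> t0]]; apply/asboolP.
exists ([seq (c *: p.1, p.2) | p <- s] ++ t); split=> [|rho].
  rewrite big_cat big_map scaler_sumr; congr (_ + _).
  by apply: eq_bigr => p _; rewrite tensZl.
rewrite big_cat big_map /= t0 addr0 -[RHS](s0 (c *: rho)).
by apply: eq_bigr => p _; rewrite /kcomp !fglift2E.
Qed.

HB.instance Definition _ :=
  GRing.isSubmodClosed.Build k Lfun Jpred Jpred_closed.

End LJ.

(** The order of [E : finPOrderType d] plays the role of R, so that R^op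
    corresponds to [E^d]. *)

Definition order_rel d (E : finPOrderType d) : {set E * E} :=
  [set p | (p.1 <= p.2)%O].

Section FundamentalModule.
Context (k : comNzRingType) (d : Order.disp_t) (E : finPOrderType d).
Implicit Types (Q : {set E * E}) (a b : {perm E}).

Definition fund_cond Q a b : bool :=
  (diag E \subset corr_comp (perm_corr b^-1) Q) &&
  (corr_comp (perm_corr b^-1) Q \subset conj_corr a (order_rel E)).

(** Permutations act on the right in MathComp: [(a * b)%g] is "first [a], then
    [b]", i.e. the composite written beta alpha when maps act on the left. *)
Definition fund_act Q a : option {perm E} :=
  omap (fun b => (a * b)%g) [pick b | fund_cond Q a b].

(** The basis element [<< a >>] stands for Delta_a f_R. *)
Definition fund_mod := {freeg {perm E} / k}.

HB.instance Definition _ := GRing.Zmodule.on fund_mod.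

Definition fund_basis a : fund_mod := << a >>.

Definition fund_scale (x : kcorr_alg k E) (w : fund_mod) : fund_mod :=
  fglift2 (fun Q a => oapp fund_basis 0 (fund_act Q a) : {freeg {perm E} / k})
    x w.

Lemma fund_condP Q a b : reflect
  ((forall e, (b e, e) \in Q) /\
   (forall x y, (b x, y) \in Q -> ((a^-1)%g x <= (a^-1)%g y)%O))
  (fund_cond Q a b).
Proof.
apply: (iffP andP) => -[]; first move=> /subsetP Qd /subsetP Qs.
  split.
    by move=> e; rewrite -perm_corr_compE; apply: Qd; rewrite in_diag.
  move=> x y Qxy; have := Qs (x, y); rewrite perm_corr_compE conj_corrE.
  by rewrite inE; apply.
move=> Qd Qs; split; apply/subsetP => -[x y].
  by rewrite in_diag perm_corr_compE => /eqP->.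
by rewrite perm_corr_compE conj_corrE inE; apply: Qs.
Qed.

Lemma perm_le_id (s : {perm E}) : (forall x, (s x <= x)%O) -> s = 1%g.
Proof.
move=> s_le; apply/permP => x; rewrite perm1; apply/le_anti/andP; split=> //.
have iter_le n y : ((s ^+ n)%g y <= y)%O.
  elim: n => [|n IHn]; first by rewrite expg0 perm1.
  by rewrite expgSr permM; apply: le_trans (s_le _) IHn.
have := iter_le #[s]%g.-1 (s x).
by rewrite -permM -expgS prednK ?order_gt0 // expg_order perm1.
Qed.

Lemma fund_cond_uniq Q a b c : fund_cond Q a b -> fund_cond Q a c -> b = c.
Proof.
move=> /fund_condP[bQ bR] /fund_condP[cQ cR].
have /perm_le_id : forall x, ((a * c * b^-1 * a^-1)%g x <= x)%O.
  move=> x; rewrite !permM; have := bR ((b^-1)%g (c (a x))) (a x).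
  by rewrite permKV permK; apply; apply: cQ.
move=> /(congr1 (fun s => a^-1 * s * a * b)%g).
by rewrite mulg1 !mulgA mulVg mul1g !mulgKV => ->; rewrite mul1g.
Qed.

Lemma fund_actE Q a b : fund_cond Q a b -> fund_act Q a = Some (a * b)%g.
Proof.
move=> Qab; rewrite /fund_act; case: pickP => [c Qac|/(_ b)]; last by rewrite Qab.
by rewrite (fund_cond_uniq Qab Qac).
Qed.

Lemma fund_act1 a : fund_act (diag E) a = Some a.
Proof.
rewrite -[a in RHS]mulg1; apply: fund_actE; apply/fund_condP; split=> [e|x y].
  by rewrite in_diag perm1.
by rewrite in_diag perm1 => /eqP->.
Qed.

Lemma fund_condM Q P a b c : fund_cond P a b -> fund_cond Q (a * b)%g c ->
  fund_cond (corr_comp Q P) a (b * c)%g.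
Proof.
move=> /fund_condP[bP bR] /fund_condP[cQ cR]; apply/fund_condP; split=> [e|x y].
  by apply/corr_compP; exists (b e); rewrite ?permM.
case/corr_compP => z; rewrite permM => /cR + Pzy.
rewrite invMg !permM permK => /le_trans; apply.
by apply: bR; rewrite permKV.
Qed.

Lemma fund_cond_split Q P a g : fund_cond (corr_comp Q P) a g ->
  exists b c, fund_cond P a b /\ fund_cond Q (a * b)%g c.
Proof.
move=> /fund_condP[gQP gR].
have ex e : exists f, ((g e, f) \in Q) && ((f, e) \in P).
  by have /corr_compP[f] := gQP e; exists f; apply/andP.
pose h e := xchoose (ex e).
have hQ e : (g e, h e) \in Q by case/andP: (xchooseP (ex e)).
have hP e : (h e, e) \in P by case/andP: (xchooseP (ex e)).
have le_h x y : h x = h y -> ((a^-1)%g x <= (a^-1)%g y)%O.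
  by move=> hxy; apply: gR; apply/corr_compP; exists (h x); rewrite // hxy.
have h_inj : injective h.
  move=> x y hxy; apply: (@perm_inj _ (a^-1)%g); apply/le_anti.
  by rewrite !le_h.
pose b := perm h_inj; exists b, (b^-1 * g)%g; split; apply/fund_condP; split.
- by move=> e; rewrite permE.
- move=> x y; rewrite permE => hxy; apply: gR; apply/corr_compP.
  by exists (h x).
- by move=> e; rewrite permM -{2}[e](permKV b) [X in (_, X)]permE.
move=> x y; rewrite permM => Qxy; rewrite invMg !permM.
apply: gR; apply/corr_compP; exists y => //.
by rewrite -{1}[y](permKV b) permE.
Qed.

Lemma fund_actM Q P a :
  fund_act (corr_comp Q P) a = obind (fund_act Q) (fund_act P a).
Proof.
have [g QPg|QP0] := pickP (fund_cond (corr_comp Q P) a).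
  have [b [c [Pb Qc]]] := fund_cond_split QPg.
  rewrite (fund_actE (fund_condM Pb Qc)) (fund_actE Pb) /= (fund_actE Qc).
  by rewrite mulgA.
have ->: fund_act (corr_comp Q P) a = None.
  by rewrite /fund_act; case: pickP => // c; rewrite QP0.
rewrite {2}/fund_act; case: pickP => //= b Pb.
rewrite /fund_act; case: pickP => //= c Qc.
by have := QP0 (b * c)%g; rewrite fund_condM.
Qed.

Fact fund_scalerA x y w :
  fund_scale x (fund_scale y w) = fund_scale (x * y) w.
Proof.
rewrite -[x * y]/(kcomp x y) /fund_scale /kcomp.
elim/freeg_lin_ind: x => [|c Q x IHx]; first by rewrite !fglift2E.
rewrite !fglift2E {}IHx; congr (_ *: _ + _).
elim/freeg_lin_ind: y => [|c' P y IHy]; first by rewrite !fglift2E.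
rewrite !fglift2E {}IHy; congr (_ *: _ + _).
elim/freeg_lin_ind: w => [|e a w IHw]; first by rewrite !fglift2E.
rewrite !fglift2E {}IHw; congr (_ *: _ + _).
by rewrite fund_actM; case: (fund_act P a) => [b|] /=; rewrite fglift2E.
Qed.

Fact fund_scale1r : left_id 1 fund_scale.
Proof.
move=> w; rewrite -[1]/(<< diag E >> : {freeg {set E * E} / k}) /fund_scale.
elim/freeg_lin_ind: w => [|e a w IHw]; first by rewrite !fglift2E.
by rewrite !fglift2E {}IHw fund_act1.
Qed.

Fact fund_scalerDr : right_distributive fund_scale +%R.
Proof. by move=> x v w; apply: fglift2Dr. Qed.

Fact fund_scalerDl w : {morph fund_scale^~ w : x y / x + y}.
Proof. by move=> x y; apply: fglift2Dl. Qed.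

HB.instance Definition _ := GRing.Zmodule_isLmodule.Build (kcorr_alg k E)
  fund_mod fund_scalerA fund_scale1r fund_scalerDr fund_scalerDl.

End FundamentalModule.

(** The value at [X] of the fundamental functor S_{E,R}. *)
Definition fund_functor (k : comNzRingType) (d : Order.disp_t)
    (E : finPOrderType d) (X : finType) : lmodType k :=
  quotmod (@Jpred k E (fund_mod k E) X).

Section Lattice.
Context (d : Order.disp_t) (T : finTBLatticeType d).
Local Open Scope order_scope.

Definition irreducible (e : T) : bool :=
  [forall A : {set T}, (e == \join_(a in A) a) ==> (e \in A)].

Definition irr : {set T} := [set e | irreducible e].

Definition lat_r (t : T) : T := \join_(s | s < t) s.

Definition lat_sigma (t : T) : T := \meet_(e in irr | t < e) e.

(** The iterates are stationary after [#|T|] steps: see [lat_rinfK] and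
    [lat_sigmainfK] below. *)
Definition lat_rinf (t : T) : T := iter #|T| lat_r t.

Definition lat_sigmainf (t : T) : T := iter #|T| lat_sigma t.

Lemma iter_stationary (f : T -> T) (A : T -> {set T}) (t : T) :
    (forall x, x \in A x) -> (forall x, f x != x -> A (f x) \proper A x) ->
  f (iter #|T| f t) = iter #|T| f t.
Proof.
move=> Ax Af; have: (#|A t| <= #|T|)%N by apply: max_card.
elim: #|T| t => [|n IHn] t.
  by rewrite leqn0 cards_eq0 => /eqP A0; have := Ax t; rewrite A0 inE.
have [ft _|/Af/proper_card ltA leA] := eqVneq (f t) t.
  by have -> : iter n.+1 f t = t by rewrite iter_fix.
by rewrite iterSr; apply: IHn; rewrite -ltnS; apply: leq_trans leA.
Qed.

Lemma lat_rinfK t : lat_r (lat_rinf t) = lat_rinf t.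
Proof.
have r_le x : lat_r x <= x by apply/joinsP => y /ltW.
apply: (@iter_stationary _ (fun x => [set y | y <= x])) => x; first by rewrite inE.
move=> rx; apply/properP; split.
  by apply/subsetP => y; rewrite !inE => /le_trans; apply.
exists x; rewrite !inE ?lexx //.
by apply: contraNN rx => xr; rewrite eq_le r_le.
Qed.

Lemma lat_sigmainfK t : lat_sigma (lat_sigmainf t) = lat_sigmainf t.
Proof.
have s_ge x : x <= lat_sigma x by apply/meetsP => y /andP[_ /ltW].
apply: (@iter_stationary _ (fun x => [set y | x <= y])) => x; first by rewrite inE.
move=> sx; apply/properP; split.
  by apply/subsetP => y; rewrite !inE; apply: le_trans.
exists x; rewrite !inE ?lexx //.
by apply: contraNN sx => xs; rewrite eq_le xs s_ge.
Qed.

Definition Lambda_irr : {set T} :=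
  [set \meet_(a in (A : {set T})) a | A in powerset irr].

Definition Ghat : {set T} :=
  [set t | (t \notin Lambda_irr) &&
           [exists e in irr, (t == lat_rinf e) && (lat_sigma e == e)]].

Definition Gset : {set T} := Lambda_irr :|: Ghat.

(** [is_Irr iota] identifies the poset [E] with [irr] and its induced order. *)
Definition is_Irr (dE : Order.disp_t) (E : finPOrderType dE) (iota : E -> T) :
    Prop :=
  {mono iota : x y / x <= y} /\ [set iota e | e : E] = irr.

Definition Bset (X : finType) : {set {ffun X -> T}} :=
  [set phi : {ffun X -> T} | (irr \subset [set phi x | x : X]) &&
                            ([set phi x | x : X] \subset Gset)].

End Lattice.

Section Theta.
Context (k : comNzRingType) (dE dT : Order.disp_t) (E : finPOrderType dE).
Context (T : finTBLatticeType dT) (iota : E -> T) (X : finType).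

Definition Gamma (phi : {ffun X -> T}) : {set X * E^d} :=
  [set p | (iota p.2 <= phi p.1)%O].

(** The module {freeg {ffun X -> T} / k} is F_T(X). *)
Definition Theta : {freeg {ffun X -> T} / k} -> fund_functor k E^d X :=
  fglift (fun phi =>
    quotmod_pi (@Jpred k E^d (fund_mod k E^d) X)
      (tens (<< Gamma phi >> : kcorr k X E^d) (fund_basis k 1%g))).

End Theta.

Arguments Theta k {dE dT E T} iota {X} _.

(* Main.v *)
Require Import Defs.
From mathcomp Require Import all_boot all_order all_algebra all_fingroup.
From mathcomp Require Import boolp freeg.

Set Implicit Arguments.
Unset Strict Implicit.
Unset Printing Implicit Defensive.

Import Order.TTheory GRing.Theory.

Local Open Scope ring_scope.

(** An element [sum_phi c_phi phi] of F_T(X) is killed by Theta iff its pairing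
    with every correspondence from X to E vanishes. The pairing of [phi] with a
    correspondence is 0 or 1 and has the following shape: there is a map
    [xi : X -> T] and a set [U] of "covering" positions, and the value is 1 iff
    [phi <= xi] pointwise and every irreducible [e] is attained by [phi] at some
    position of [U] where [xi] is [e]; the remaining "plain" positions carry
    values [s] with [sigma(s) = s], and all such pairs occur.

    For a fixed irreducible [e], comparing positions of value [e] and [r(e)] gives
    [<U, xi> = <U + W, xi'> - <U - Z + W, xi''>], which shows that admitting [e] as
    a plain value and admitting [r(e)] as a plain value yield the same vanishing
    conditions. Hence a set of plain values only matters through its image under
    [r^infty], so that one may replace the [sigma]-fixed values by [G - E]. Then the
    pairs [(U, xi)] that matter are exactly the maps in B_X, and the matrix
    obtained is unitriangular for the pointwise order. *)

(** * Irreducibles and the maps r and sigma in a finite lattice *)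

Section LatticeFacts.
Context (d : Order.disp_t) (T : finTBLatticeType d).
Local Open Scope order_scope.
Implicit Types s t e : T.

Lemma lat_r_le t : lat_r t <= t.
Proof. by apply/joinsP => s /ltW. Qed.

Lemma lt_le_lat_r s t : s < t -> s <= lat_r t.
Proof. exact: (@joins_sup _ _ _ s (fun x => x < t) id). Qed.

Lemma irr_lat_r_lt e : e \in irr T -> lat_r e < e.
Proof.
rewrite inE lt_neqAle lat_r_le andbT => /forallP/(_ [set s | s < e])/implyP irr_e.
apply/negP => /eqP re; suff: e \in [set s | s < e] by rewrite inE ltxx.
by apply: irr_e; rewrite -[X in X == _]re; apply/eqP/eq_bigl => s; rewrite inE.
Qed.

Lemma nirr_lat_r t : t \notin irr T -> lat_r t = t.
Proof.
rewrite inE negb_forall => /existsP[A]; rewrite negb_imply => /andP[/eqP tA tNA].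
apply/le_anti; rewrite lat_r_le [X in X <= _]tA /=; apply/joinsP => s sA.
apply: lt_le_lat_r; rewrite lt_neqAle [X in _ <= X]tA joins_sup // andbT.
by apply: contraNneq tNA => <-.
Qed.

(** Induction on the size of the down-set of [t]: an irreducible [t] is its own test element, and
    any other [t] is the join of the strictly smaller elements. *)
Lemma irr_le t u : (forall e, e \in irr T -> e <= t -> e <= u) -> t <= u.
Proof.
have [n] := ubnP #|[set s | s <= t]|; elim: n t => // n IHn t tn irr_tu.
have [/irr_tu->//|/nirr_lat_r rt] := boolP (t \in irr T).
rewrite -rt; apply/joinsP => s st; apply: IHn => [|e eI es]; last first.
  by apply: irr_tu => //; apply: le_trans es (ltW st).
rewrite -ltnS; apply: leq_trans tn; rewrite ltnS; apply: proper_card.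
apply/properP; split.
  by apply/subsetP => x; rewrite !inE => xs; apply: le_trans xs (ltW st).
by exists t; rewrite !inE ?lexx // lt_geF.
Qed.

Lemma irr_join_mem (A : {set T}) e :
  e \in irr T -> e = \join_(a in A) a -> e \in A.
Proof. by rewrite inE => /forallP/(_ A)/implyP irr_e eA; apply/irr_e/eqP. Qed.

Lemma lat_sigma_ge t : t <= lat_sigma t.
Proof. by apply/meetsP => e /andP[_ /ltW]. Qed.

(** When the meet is not in [A], all members of [A] are strictly above it, hence occur among the
    irreducibles whose meet defines [lat_sigma]. *)
Lemma meet_notin_sigma_fix (A : {set T}) : A \subset irr T ->
  \meet_(a in A) a \notin A -> lat_sigma (\meet_(a in A) a) = \meet_(a in A) a.
Proof.
move=> /subsetP AI mNA; apply/le_anti; rewrite lat_sigma_ge andbT.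
apply/meetsP => a aA; apply: meets_inf; rewrite AI //= lt_neqAle meets_inf //.
by rewrite andbT; apply: contraNneq mNA => ->.
Qed.

Lemma sigma_fix_Lambda t : lat_sigma t = t -> t \in Lambda_irr T.
Proof.
move=> st; apply/imsetP; exists [set e in irr T | t < e].
  by rewrite inE; apply/subsetP => e; rewrite inE => /andP[].
by rewrite -[LHS]st; apply: eq_bigl => e; rewrite inE.
Qed.

Lemma Lambda_nirr_sigma_fix t :
  t \in Lambda_irr T -> t \notin irr T -> lat_sigma t = t.
Proof.
move=> /imsetP[A]; rewrite inE => AI -> tI; apply: meet_notin_sigma_fix => //.
by apply: contraNN tI; apply: (subsetP AI).
Qed.

Lemma irr_subset_Gset : irr T \subset Gset T.
Proof.
apply/subsetP => e eI; apply/setUP; left; apply/imsetP; exists [set e].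
  by rewrite inE sub1set.
by rewrite big_set1.
Qed.

Lemma rinf_nirr t : lat_rinf t \notin irr T.
Proof.
apply/negP => /irr_lat_r_lt; rewrite lat_rinfK; exact/negP/negbT/ltxx.
Qed.

Lemma rinf_id t : lat_rinf (lat_rinf t) = lat_rinf t.
Proof. by rewrite [LHS]iter_fix ?lat_rinfK. Qed.

End LatticeFacts.

(** * The covering condition and its two splitting identities *)

Section Cover.
Context (d : Order.disp_t) (T : finTBLatticeType d) (X : finType).
Local Open Scope order_scope.
Implicit Types (U : {set X}) (xi phi : {ffun X -> T}) (e : T).

(* Evaluating [Gamma phi] against a correspondence from [X] to [E] depends only on
   the meet [xi x] of the fibre of each [x] and on the set [U] of those [x] whose
   fibre contains its meet; see [fund_hit_Gamma]. *)
Definition covers U xi phi : bool :=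
  [forall x, phi x <= xi x] &&
  [forall e in irr T, exists x in U, (phi x == e) && (xi x == e)].

Lemma coversP U xi phi : reflect ((forall x, phi x <= xi x) /\
    forall e, e \in irr T -> exists2 x, x \in U & phi x = e /\ xi x = e)
  (covers U xi phi).
Proof.
apply: (iffP andP) => -[/forallP le_phi cov]; split => //.
  move=> e eI; have /forall_inP/(_ e eI)/exists_inP[x xU /andP[/eqP ? /eqP ?]] := cov.
  by exists x.
apply/forall_inP => e /cov[x xU [phix xix]]; apply/exists_inP.
by exists x; rewrite // phix xix eqxx.
Qed.

Definition reval xi (s e : T) U : {ffun X -> T} :=
  [ffun x => if (xi x == s) && (x \in U) then e else xi x].

Lemma le_irr_lat_r e s : e \in irr T -> s <= e -> (s == e) || (s <= lat_r e).
Proof.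
by move=> eI; rewrite le_eqVlt => /orP[->//|/lt_le_lat_r->]; rewrite orbT.
Qed.

(* [V :&: U] are the covering and [V :\: U] the plain positions of value [e]. If
   every position of value [e] is made covering, then either some position in
   [V :&: U] takes the value [e], or all of them stay below [lat_r e] and [e] is
   reached in [V :\: U]. *)
Lemma covers_lower U xi phi e (V := [set x | xi x == e]) : e \in irr T ->
  covers (U :|: V) xi phi = (covers U xi phi +
    covers ((U :\: V) :|: (V :\: U)) (reval xi e (lat_r e) U) phi)%N :> nat.
Proof.
move=> eI.
case: (boolP [exists x in U, (phi x == e) && (xi x == e)]) => [|no_e].
- move=> /exists_inP[x xU /andP[/eqP phix /eqP xix]].
  rewrite [covers (_ :|: (V :\: U)) _ _](_ : _ = false) ?addn0; last first.
    apply/negP => /coversP[/(_ x) + _]; rewrite ffunE xix eqxx xU phix /=.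
    by rewrite lt_geF ?irr_lat_r_lt.
  congr nat_of_bool; apply/coversP/coversP => -[le_phi cov]; last first.
    by split=> // f /cov[y yU yf]; exists y; rewrite // inE yU.
  split=> // f fI; have [->|fNe] := eqVneq f e; first by exists x.
  have [y + [yf xiy]] := cov f fI; rewrite !inE xiy (negPf fNe) orbF => yU.
  by exists y.
rewrite [covers U xi phi](_ : _ = false) ?add0n; last first.
  apply/negP => /coversP[_ /(_ _ eI)[x xU [xe xie]]]; case/exists_inP: no_e.
  by exists x; rewrite // xe xie !eqxx.
congr nat_of_bool; apply/coversP/coversP => -[le_phi cov]; split.
- move=> x; rewrite ffunE; case: ifP => [/andP[/eqP xix xU]|//].
  have := le_phi x; rewrite xix => /(le_irr_lat_r eI)/orP[phix|//].
  by case/exists_inP: no_e; exists x; rewrite // phix xix eqxx.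
- move=> f fI; have [x xUV [xf xix]] := cov f fI.
  have xNU : xi x == e -> x \notin U.
    move=> xie; apply: contraNN no_e => xU; apply/exists_inP; exists x => //.
    by rewrite xie andbT xf -xix.
  exists x; last first.
    by split=> //; rewrite ffunE; case: ifP => // /andP[/xNU/negP].
  move: xUV xNU; rewrite !inE; case: (xi x == e) => /=; last by rewrite orbF => ->.
  by move=> _ ->.
- move=> x; apply: le_trans (le_phi x) _; rewrite ffunE; case: ifP => //.
  by case/andP=> /eqP-> _; apply: lat_r_le.
move=> f fI; have [x xUV [xf]] := cov f fI; move: xUV; rewrite ffunE !inE.
case: ifP => [/andP[-> ->]//|_ xUV xif]; exists x => //; rewrite !inE.
by case/orP: xUV => /andP[? ->]; rewrite ?orbT.
Qed.

(** Counterpart of [covers_lower] for plain positions of value [lat_r e], raised to [e] and made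
    covering. If [phi] reaches [e] on [V :\: U], it is not below [xi], and the last term agrees with
    the left-hand side. Otherwise [phi] stays below [lat_r e] there, and [e] can only be attained
    inside [U]. *)
Lemma covers_raise U xi phi e (V := [set x | xi x == lat_r e])
    (xi1 := reval xi (lat_r e) e (~: U)) (Z := [set x | xi x == e]) :
  e \in irr T ->
  covers (U :|: V) xi1 phi =
  (covers U xi phi + covers ((U :\: Z) :|: (V :\: U)) xi1 phi)%N :> nat.
Proof.
move=> eI; have re : (lat_r e == e) = false by rewrite lt_eqF ?irr_lat_r_lt.
have xi1U x : x \in U -> xi1 x = xi x by move=> xU; rewrite ffunE !inE xU andbF.
have xi1W x : x \notin U -> xi x = lat_r e -> xi1 x = e.
  by move=> xU xix; rewrite ffunE !inE xU xix eqxx.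
case: (boolP [exists x in V :\: U, phi x == e]) => [|no_e].
- move=> /exists_inP[x /setDP[+ xU] /eqP phix]; rewrite inE => /eqP xix.
  rewrite [covers U xi phi](_ : _ = false) ?add0n; last first.
    by apply/negP => /coversP[/(_ x) + _]; rewrite xix phix lt_geF ?irr_lat_r_lt.
  congr nat_of_bool; apply/coversP/coversP => -[le_phi cov]; split=> // f fI.
    have [->|fNe] := eqVneq f e.
      by exists x; rewrite ?phix ?xi1W // !inE xix eqxx xU orbT.
    have [y yUV [yf xiy]] := cov f fI; exists y => //.
    move: yUV; rewrite !inE; case: (boolP (y \in U)) => /= [yU _|_ ->]; last by rewrite orbT.
    by rewrite -(xi1U _ yU) xiy fNe.
  have [y yUV yf] := cov f fI; exists y => //; move: yUV; rewrite !inE.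
  by case/orP=> /andP[? ->]; rewrite ?orbT.
rewrite [covers (_ :|: (V :\: U)) _ _](_ : _ = false) ?addn0; last first.
  apply/negP => /coversP[_ /(_ _ eI)[x + [xe xie]]]; rewrite inE => /orP[].
    by rewrite !inE => /andP[+ xU]; rewrite -(xi1U _ xU) xie eqxx.
  by move=> xVU; case/exists_inP: no_e; exists x; rewrite ?xe.
congr nat_of_bool; apply/coversP/coversP => -[le_phi cov]; split.
- move=> x; move: (le_phi x); have [xU|xU] := boolP (x \in U); first by rewrite xi1U.
  rewrite ffunE !inE xU andbT; case: eqP => // xix.
  move=> /(le_irr_lat_r eI)/orP[phix|]; last by rewrite xix.
  by case/exists_inP: no_e; exists x; rewrite // !inE xU xix eqxx.
- move=> f fI; have [x xUV [xf xif]] := cov f fI; exists x.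
    move: xUV; rewrite !inE => /orP[//|xix]; apply: contraNT no_e => xU.
    by apply/exists_inP; exists x; rewrite ?inE ?inE ?xU // xf -xif xi1W //; apply/eqP.
  have [xU|xU] := boolP (x \in U); first by rewrite -xi1U.
  move: xUV; rewrite !inE (negPf xU) /= => xix.
  by case/exists_inP: no_e; exists x; rewrite ?inE ?xU // xf -xif xi1W //; apply/eqP.
- move=> x; apply: le_trans (le_phi x) _; rewrite ffunE; case: ifP => //.
  by case/andP=> /eqP-> _; apply: lat_r_le.
by move=> f /cov[x xU [xf xif]]; exists x; rewrite ?xi1U // inE xU.
Qed.
End Cover.

(** * Vanishing conditions and changes of the set of plain values *)

Section CoverNull.
Context (k : comNzRingType) (d : Order.disp_t) (T : finTBLatticeType d).
Context (X : finType) (c : {ffun X -> T} -> k).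
Implicit Types (U : {set X}) (xi : {ffun X -> T}) (P Q : {set T}).

Definition cover_null P := forall U xi,
  (forall x, x \in U -> xi x \in irr T) -> (forall x, x \notin U -> xi x \in P) ->
  \sum_phi c phi * (covers U xi phi)%:R = 0.

Lemma cover_nullS P Q : P \subset Q -> cover_null Q -> cover_null P.
Proof.
move=> /subsetP PQ nullQ U xi xiU xiP; apply: nullQ => // x /xiP; exact: PQ.
Qed.

Lemma cover_null_of_split U V W xi xi' xi'' :
  (forall phi, covers V xi' phi = (covers U xi phi + covers W xi'' phi)%N :> nat) ->
  \sum_phi c phi * (covers V xi' phi)%:R = 0 ->
  \sum_phi c phi * (covers W xi'' phi)%:R = 0 ->
  \sum_phi c phi * (covers U xi phi)%:R = 0.
Proof.
move=> splitU V0 W0; rewrite -[RHS]V0 -[LHS]addr0 -[X in _ + X]W0 -big_split.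
by apply: eq_bigr => phi _; rewrite splitU natrD mulrDr.
Qed.

(** In both other terms of [covers_raise], plain positions of value [lat_r e] have become covering
    with value [e]; the last term also makes covering positions of value [e] plain, whence
    [e \in P]. *)
Lemma cover_null_lat_r P e : cover_null P -> e \in irr T -> e \in P ->
  cover_null (lat_r e |: P).
Proof.
move=> nullP eI eP U xi xiU xiP.
have xiP' x : x \notin U -> xi x != lat_r e -> xi x \in P.
  by move=> /xiP; rewrite !inE => /predU1P[->|//]; rewrite eqxx.
have eI' : irreducible e by rewrite inE in eI.
have xiU' x : x \in U -> irreducible (xi x) by move=> /xiU; rewrite inE.
apply: cover_null_of_split (fun phi => covers_raise U xi phi eI) _ _.
  apply: nullP => x; rewrite !inE ffunE inE; have [xU|xU] := boolP (x \in U).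
  - by rewrite andbF => _; apply: xiU'.
  - by rewrite andbT /= => ->.
  - by [].
  by move=> /= xie; rewrite (negPf xie); apply: xiP'.
apply: nullP => x; rewrite !inE ffunE inE; have [xU|xU] := boolP (x \in U).
- by rewrite !andbF orbF => _; apply: xiU'.
- by rewrite !andbT andbF /= => ->.
- by rewrite !andbF andbT orbF negbK => /eqP->.
by rewrite !andbT andbF /= => xie; rewrite (negPf xie); apply: xiP'.
Qed.

(** In both other terms of [covers_lower], plain positions of value [e] have become covering; in the
    last one, the former covering positions of value [e] are plain with value [lat_r e]. *)
Lemma cover_null_lat_rV P e : cover_null P -> e \in irr T -> lat_r e \in P ->
  cover_null (e |: P).
Proof.
move=> nullP eI reP U xi xiU xiP.
have xiP' x : x \notin U -> xi x != e -> xi x \in P.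
  by move=> /xiP; rewrite !inE => /predU1P[->|//]; rewrite eqxx.
have eI' : irreducible e by rewrite inE in eI.
have xiU' x : x \in U -> irreducible (xi x) by move=> /xiU; rewrite inE.
apply: cover_null_of_split (fun phi => covers_lower U xi phi eI) _ _.
  apply: nullP => x; rewrite !inE; have [xU|xU] /= := boolP (x \in U).
  - by move=> _; apply: xiU'.
  - by move=> /eqP->.
  - by [].
  exact: xiP'.
apply: nullP => x; rewrite !inE ffunE; have [xU|xU] := boolP (x \in U).
- by rewrite /= !(andbT, andbF, orbF) => xie; rewrite (negPf xie); apply: xiU'.
- by rewrite /= !(andbT, andbF, orbF) => /eqP->.
- by rewrite /= !(andbT, andbF, orbF) negbK => ->.
by rewrite /= !(andbT, andbF, orbF); apply: xiP'.
Qed.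

(** By the two preceding lemmas, a maximal admissible set of plain values containing [P] is stable
    under [lat_r] in both directions, so membership in it depends only on [lat_rinf]. *)
Lemma cover_null_closure P : cover_null P ->
  cover_null [set s | lat_rinf s \in [set lat_rinf t | t in P]].
Proof.
move=> nullP.
have [|Q /maxsetP[/asboolP[PQ nullQ] maxQ]] :=
  @ex_maxset _ (fun Q => `[< P \subset Q /\ cover_null Q >]).
  by exists P; apply/asboolP.
have addQ s : cover_null (s |: Q) -> s \in Q.
  move=> nullsQ; suff <- : s |: Q = Q by rewrite setU11.
  apply: maxQ; last exact: subsetU1.
  by apply/asboolP; split=> //; apply: subset_trans (subsetU1 _ _).
have rQ s : (lat_r s \in Q) = (s \in Q).
  have [sI|/nirr_lat_r->//] := boolP (s \in irr T).
  apply/idP/idP => sQ; apply: addQ.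
    exact: cover_null_lat_rV.
  exact: cover_null_lat_r.
have iterQ n s : (iter n (@lat_r _ T) s \in Q) = (s \in Q).
  by elim: n => //= n <-; rewrite rQ.
apply: cover_nullS nullQ; apply/subsetP => s; rewrite inE => /imsetP[t tP].
by move=> rinf_st; rewrite -(iterQ #|T|) -/(lat_rinf s) rinf_st iterQ (subsetP PQ).
Qed.

(* The left-hand set contains the plain values of genuine correspondences
   (cf. [fund_hit_Gamma]); both sets have the same image under [lat_rinf]. *)
Lemma cover_null_Gset :
  cover_null [set s | lat_sigma s == s] <-> cover_null (Gset T :\: irr T).
Proof.
split=> /cover_null_closure; apply: cover_nullS; apply/subsetP => s; rewrite !inE.
  case/andP=> sI /orP[sL|/andP[_ /exists_inP[e eI /andP[/eqP -> /eqP se]]]].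
    by apply/imsetP; exists s; rewrite // inE Lambda_nirr_sigma_fix // inE.
  by apply/imsetP; exists e; rewrite ?rinf_id // inE se.
move=> /eqP ss; have sL := sigma_fix_Lambda ss.
have [sI|sI] := boolP (s \in irr T); last first.
  by apply/imsetP; exists s; rewrite // in_setD sI in_setU sL.
(* A sigma-fixed irreducible is represented by its [lat_rinf], which belongs to [Ghat] whenever it
   is outside [Lambda_irr]. *)
apply/imsetP; exists (lat_rinf s); last by rewrite rinf_id.
rewrite in_setD rinf_nirr in_setU inE; case: (boolP (_ \in Lambda_irr T)) => //= _.
by apply/exists_inP; exists s; rewrite ?ss ?eqxx.
Qed.

End CoverNull.

(** * Unitriangular linear systems *)

Section Triangular.
Context (k : comNzRingType) (I : finType) (B : {set I}).
Context (M : I -> I -> k) (h : I -> nat).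
Context (M1 : forall i, i \in B -> M i i = 1).
Context (M0 : {in B &, forall i j, i != j -> (h j <= h i)%N -> M i j = 0}).

(** Strong induction on [h j]: in equation [j], off-diagonal terms of height at least [h j] vanish
    by [M0], and the lower ones by induction. *)
Lemma triangular_inj (a : I -> k) :
  {in B, forall j, \sum_(i in B) a i * M i j = 0} -> {in B, forall i, a i = 0}.
Proof.
move=> aM0 j; have [n] := ubnP (h j); elim: n j => // n IHn j hj jB.
rewrite -[RHS](aM0 j jB) (bigD1 j jB) /= M1 // mulr1 big1 ?addr0 // => i /andP[iB ij].
have [/(M0 iB jB ij)->|hij] := leqP (h j) (h i); first by rewrite mulr0.
by rewrite IHn ?mul0r //; apply: leq_trans hij _; rewrite -ltnS.
Qed.

(** Substitution by increasing height; distinct indices of equal height do not interact, by [M0]. *)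
Lemma triangular_solve (v : I -> k) :
  exists a : I -> k, {in B, forall j, \sum_(i in B) a i * M i j = v j}.
Proof.
suff /(_ (\max_i h i).+1)[a aP] n : exists a : I -> k,
    {in B, forall j, (h j < n)%N -> \sum_(i in B) a i * M i j = v j}.
  by exists a => j jB; apply: aP => //; rewrite ltnS leq_bigmax.
elim: n => [|n [a aP]]; first by exists (fun=> 0).
(* The second branch solves equation [j] at height [n]. Its values at greater heights do not matter,
   since [M0] removes them from the equations considered. *)
pose b j := if (h j < n)%N then a j
  else v j - \sum_(i in B | (i != j) && (h i < n)%N) a i * M i j.
exists b => j jB; rewrite ltnS leq_eqVlt => /orP[/eqP hj|hj]; last first.
  rewrite -[RHS](aP j jB hj); apply: eq_bigr => i iB; rewrite /b.
  have [//|hi] := ltnP (h i) n.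
  rewrite (M0 iB jB) ?mulr0 //; last by apply: leq_trans (ltnW hj) hi.
  by apply: contraTneq hi => ->; rewrite -ltnNge.
rewrite (bigD1 j jB) /= M1 // mulr1 {1}/b hj ltnn -[RHS]addr0 -addrA; congr (_ + _).
rewrite addrC (bigID (fun i => h i < n)%N) /= [X in _ + X - _]big1 => [|i].
  rewrite addr0; apply/eqP; rewrite subr_eq0; apply/eqP; apply: eq_big => i.
    by rewrite andbA.
  by case/andP=> _ hi; rewrite /b hi.
by case/andP=> /andP[iB ij]; rewrite -leqNgt -hj => /(M0 iB jB ij)->; rewrite mulr0.
Qed.

End Triangular.

(** * Counting maps with required and allowed values *)

Section CountSurj.
Context (T X : finType).
Implicit Types A G : {set T}.

Definition maps_between A G : {set {ffun X -> T}} :=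
  [set phi : {ffun X -> T} |
    (A \subset [set phi x | x : X]) && ([set phi x | x : X] \subset G)].

Lemma card_maps_between0 G : #|maps_between set0 G| = (#|G| ^ #|X|)%N.
Proof.
rewrite -card_ffun_on; apply: eq_card => phi; rewrite inE sub0set /=.
apply/subsetP/ffun_onP => [phiG x|phiG _ /imsetP[x _ ->]//].
by apply: phiG; apply: imset_f.
Qed.

Lemma card_maps_betweenU1 a A G : a \notin A ->
  (#|maps_between (a |: A) G| + #|maps_between A (G :\ a)|)%N =
  #|maps_between A G|.
Proof.
move=> aA; rewrite -[RHS](cardsID [set phi : {ffun X -> T} | a \in [set phi x | x : X]]).
congr addn; apply: eq_card => phi; rewrite !inE ?subUset ?sub1set.
  by rewrite [RHS]andbC andbA.
by rewrite subsetD1 [RHS]andbC andbA.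
Qed.

(** Inclusion-exclusion by induction on [#|A|]: dropping one required value with
    [card_maps_betweenU1] leads to Pascal's rule. *)
Lemma card_maps_between A G : A \subset G -> #|maps_between A G|%:Z =
  \sum_(0 <= i < #|A|.+1) (-1) ^+ i * 'C(#|A|, i)%:Z * (#|G|%:Z - i%:Z) ^+ #|X|.
Proof.
have [n] := ubnP #|A|; elim: n A G => // n IHn A G.
have [->|[a aA]] := set_0Vmem A => An AG.
  by rewrite cards0 big_nat1 card_maps_between0 bin0 expr0 !mul1r subr0 -!natz natrX.
rewrite -(setD1K aA); set A' := A :\ a; have aA' : a \notin A' by rewrite setD11.
have A'G : A' \subset G by apply: subset_trans AG; apply: subsetDl.
have A'Ga : A' \subset G :\ a by apply: setSD.
have aG : a \in G by apply: (subsetP AG).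
have cA : #|a |: A'| = #|A'|.+1 by rewrite cardsU1 aA'.
have {}An : (#|A'| < n)%N by rewrite -ltnS -cA setD1K.
have /(canRL (addrK _)) -> : #|maps_between (a |: A') G|%:Z
    + #|maps_between A' (G :\ a)|%:Z = #|maps_between A' G|%:Z.
  by rewrite -PoszD card_maps_betweenU1.
rewrite !IHn // cA; set m := #|A'|.
have -> : #|G|%:Z = #|G :\ a|%:Z + 1 by rewrite [#|G|](cardsD1 a) aG PoszD addrC.
set g := #|G :\ a|%:Z.
(* The added term at [m.+1] is zero; splitting off index 0 then aligns this sum with the one for
   [G :\ a]. *)
have -> : \sum_(0 <= i < m.+1) (-1) ^+ i * 'C(m, i)%:Z * (g + 1 - i%:Z) ^+ #|X| =
    \sum_(0 <= i < m.+2) (-1) ^+ i * 'C(m, i)%:Z * (g + 1 - i%:Z) ^+ #|X|.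
  by rewrite [RHS]big_nat_recr //= bin_small // mulr0 mul0r addr0.
rewrite [in LHS]big_nat_recl // [RHS]big_nat_recl // !bin0 -addrA -sumrB.
congr (_ + _); apply: eq_bigr => i _.
have -> : g + 1 - i.+1%:Z = g - i%:Z by rewrite intS [1 + _]addrC opprD addrACA subrr addr0.
rewrite -mulrBl binS; congr (_ * _).
by rewrite exprS mulN1r !mulNr -opprD -mulrDr PoszD.
Qed.

End CountSurj.

(** * Evaluations and generators of the fundamental functor *)

Section FundFunctor.
Context (k : comNzRingType) (d : Order.disp_t) (E : finPOrderType d).
Context (X : finType).
Notation W := (fund_mod k E).
Implicit Types (S : {set X * E}) (rho : {set E * X}).

Definition fund_class S : fund_functor k E X :=
  quotmod_pi (@Jpred k E W X) (tens (<< S >> : kcorr k X E) (fund_basis k 1%g)).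

(** The 0-1 coefficient of [f_R] in the action of the composite of [rho] and [S] on [f_R]. *)
Definition fund_hit rho S : bool := fund_cond (corr_comp rho S) 1%g 1%g.

(* Well defined on the tensor product (see [tens_eval_rel]); membership in J is
   the vanishing of all these evaluations. *)
Definition tens_eval (rho : kcorr k E X) (D : {freeg (kcorr k X E * W) / k}) :
    {freeg {perm E} / k} :=
  fglift (fun p : kcorr k X E * W =>
    ((kcomp rho p.1 : kcorr_alg k E) *: p.2 : W) : {freeg {perm E} / k}) D.

Lemma kcorr_alg_scaleE (x : kcorr_alg k E) (w : W) : x *: w = fund_scale x w.
Proof. by []. Qed.

Lemma tens_eval_rel (rho : kcorr k E X) (D : {freeg (kcorr k X E * W) / k}) : tensor_rel D -> tens_eval rho D = 0.
Proof.
rewrite /tens_eval; case=> [f g w|f v w|c f w|f a w].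
- rewrite !fglift_additive !fgliftU /= /kcomp fglift2Dr.
  by rewrite !kcorr_alg_scaleE /fund_scale fglift2Dl addrAC addrK subrr.
- rewrite !fglift_additive !fgliftU /=.
  by rewrite !kcorr_alg_scaleE /fund_scale fglift2Dr addrAC addrK subrr.
- rewrite fglift_additive fglift_scalable !fgliftU /= /kcomp fglift2Zr.
  by rewrite !kcorr_alg_scaleE /fund_scale fglift2Zl subrr.
rewrite fglift_additive !fgliftU /= kcompA.
by rewrite -[kcomp (kcomp _ _) _]/((kcomp rho f : kcorr_alg k E) * a) -scalerA subrr.
Qed.

Lemma tens_eval_span (rho : kcorr k E X) (D : {freeg (kcorr k X E * W) / k}) : D \in span_pred (@tensor_rel k E W X) ->
  tens_eval rho D = 0.
Proof.
move=> /asboolP[s [sR ->]]; rewrite /tens_eval raddf_sum big_seq big1 // => p ps.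
by rewrite /= fglift_scalable -/(tens_eval rho p.2) tens_eval_rel ?scaler0 //; apply: sR.
Qed.

(** Coefficients at other permutations are pairings with a translated correspondence, so it suffices
    to test all [rho] at the identity. *)
Lemma fund_cond_perm rho S (b : {perm E}) :
  fund_cond (corr_comp rho S) 1%g b =
  fund_hit (corr_comp (perm_corr b^-1) rho) S.
Proof.
rewrite /fund_hit -corr_compA.
apply/fund_condP/fund_condP => -[b1 b2]; split=> [e|x y].
- by rewrite perm1 perm_corr_compE.
- by rewrite perm1 perm_corr_compE; apply: b2.
- by rewrite -perm_corr_compE -{1}[e]perm1.
by rewrite -perm_corr_compE -{1}[x](perm1 x); apply: b2.
Qed.

Lemma fund_hitP rho S : reflect
  ((forall e, exists2 x, (e, x) \in rho & (x, e) \in S) /\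
   (forall e x f, (e, x) \in rho -> (x, f) \in S -> (e <= f)%O))
  (fund_hit rho S).
Proof.
apply: (iffP (fund_condP _ _ _)) => -[hit le_hit]; split.
- by move=> e; apply/corr_compP; rewrite -[e in (e, _)]perm1.
- move=> e x f ex xf; have := le_hit e f; rewrite invg1 !perm1; apply.
  by apply/corr_compP; exists x.
- by move=> e; rewrite perm1; apply/corr_compP.
by move=> e f; rewrite invg1 !perm1 => /corr_compP[x ex xf]; apply: le_hit xf.
Qed.

Lemma coeff_fund_act (Q : {set E * E}) (b : {perm E}) :
  coeff b (oapp (@fund_basis k d E) 0 (fund_act Q 1%g) : {freeg {perm E} / k}) =
  (fund_cond Q 1%g b)%:R.
Proof.
rewrite /fund_act; case: pickP => [a Qa|Q0] /=; last by rewrite coeff0 Q0.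
rewrite mul1g coeffU mul1r; congr (nat_of_bool _)%:R.
by apply/eqP/idP => [<-//|/(fund_cond_uniq Qa)].
Qed.

(** Membership in J is tested by evaluations; linearity reduces the test morphisms to single
    correspondences, and [fund_cond_perm] reduces all coefficients to the one at the identity. *)
Lemma fund_class_eq0 (I : finType) (c : I -> k) (S : I -> {set X * E}) :
  \sum_i c i *: fund_class (S i) = 0 <->
  forall rho, \sum_i c i * (fund_hit rho (S i))%:R = 0.
Proof.
pose w1 : W := fund_basis k 1%g.
pose s := [seq (c i *: << S i >> : kcorr k X E, w1) | i <- index_enum I].
have evalE rho : \sum_i (kcomp << rho >> (c i *: << S i >>) : kcorr_alg k E) *: w1 =
    \sum_i c i *: (oapp (@fund_basis k d E) 0 (fund_act (corr_comp rho (S i)) 1%g) :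
       {freeg {perm E} / k}) :> {freeg {perm E} / k}.
  apply: eq_bigr => i _; rewrite kcorr_alg_scaleE /kcomp /fund_scale.
  by rewrite /w1 /fund_basis !fglift2E.
have piE : \sum_i c i *: fund_class (S i) =
    quotmod_pi _ (\sum_i c i *: tens (<< S i >> : kcorr k X E) w1).
  by rewrite raddf_sum; apply: eq_bigr => i _; rewrite /= linearZ.
rewrite {}piE; split=> [/eqP|hit0].
- rewrite -(raddf0 (quotmod_pi (@Jpred k E W X))) quotmod_eqP subr0.
  (* The representative [t] need not be [s], but they differ by an element of the span of the tensor
     relations, where [tens_eval] vanishes. *)
  move=> /asboolP[t [tE t0]] rho.
  pose D : {freeg (kcorr k X E * W) / k} := \sum_(p <- s) << p >>.
  pose D' : {freeg (kcorr k X E * W) / k} := \sum_(p <- t) << p >>.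
  have : D - D' \in span_pred (@tensor_rel k E W X).
    rewrite -quotmod_eqP !raddf_sum /=; apply/eqP.
    rewrite [RHS](eq_bigr (fun p => tens p.1 p.2)); last by case.
    by rewrite -tE big_map; apply: eq_bigr => i _; rewrite -tensZl.
  move=> /(tens_eval_span << rho >>); rewrite /tens_eval fglift_additive.
  have evalD (u : seq (kcorr k X E * W)) :
      tens_eval << rho >> (\sum_(p <- u) << p >>) =
      \sum_(p <- u) ((kcomp << rho >> p.1 : kcorr_alg k E) *: p.2 : W).
    by rewrite /tens_eval raddf_sum; apply: eq_bigr => p _; rewrite /= fgliftU.
  move=> /eqP; rewrite subr_eq0 => /eqP; rewrite -!/(tens_eval _ _) !evalD t0.
  rewrite big_map evalE => /(congr1 (coeff (1%g : {perm E}))).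
  rewrite raddf_sum /= coeff0 => coeff_eq0; rewrite -[RHS]coeff_eq0.
  by apply: eq_bigr => i _; rewrite coeffZ coeff_fund_act.
apply/eqP; rewrite -(raddf0 (quotmod_pi (@Jpred k E W X))) quotmod_eqP subr0.
apply/asboolP; exists s; split.
  by rewrite big_map; apply: eq_bigr => i _; rewrite tensZl.
move=> rho; rewrite big_map /=.
elim/freeg_lin_ind: rho => [|e Q rho IH].
  rewrite big1 // => i _; rewrite /kcomp fglift2E.
  by rewrite kcorr_alg_scaleE /fund_scale fglift2E.
under eq_bigr => i _ do rewrite [kcomp _ _]fglift2Dl scalerDl.
rewrite big_split /= {}IH addr0.
transitivity (e *: (\sum_i (kcomp << Q >> (c i *: << S i >>) : kcorr_alg k E) *: w1
    : {freeg {perm E} / k})).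
  rewrite scaler_sumr; apply: eq_bigr => i _.
  by rewrite fglift2Zl !kcorr_alg_scaleE /fund_scale fglift2Zl.
rewrite evalE [X in e *: X](_ : _ = 0) ?scaler0 //.
apply/eqP/freeg_eqP => b; rewrite coeff0 raddf_sum -[RHS](hit0 (corr_comp (perm_corr b^-1) Q)).
by apply: eq_bigr => i _; rewrite /= coeffZ coeff_fund_act fund_cond_perm.
Qed.

Lemma tens_rel_eq (D : {freeg (kcorr k X E * W) / k}) :
  tensor_rel D -> quotmod_pi (span_pred (@tensor_rel k E W X)) D = 0.
Proof.
move=> relD; apply/eqP; rewrite -(raddf0 (quotmod_pi (span_pred (@tensor_rel k E W X)))).
rewrite quotmod_eqP subr0; apply/asboolP; exists [:: (1, D)].
by split=> [p|]; rewrite ?big_seq1 ?scale1r // inE => /eqP->.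
Qed.

Lemma tensDl (f g : kcorr k X E) (w : W) : tens (f + g) w = tens f w + tens g w.
Proof.
apply/eqP; rewrite -subr_eq0 opprD addrA; apply/eqP.
by rewrite -(tens_rel_eq (TensorDl f g w)) !linearB.
Qed.

Lemma tensDr (f : kcorr k X E) (v w : W) : tens f (v + w) = tens f v + tens f w.
Proof.
apply/eqP; rewrite -subr_eq0 opprD addrA; apply/eqP.
by rewrite -(tens_rel_eq (TensorDr f v w)) !linearB.
Qed.

Lemma tensA (f : kcorr k X E) (a : kcorr_alg k E) (w : W) :
  tens (kcomp f a) w = tens f (a *: w).
Proof.
apply/eqP; rewrite -subr_eq0; apply/eqP.
by rewrite -(tens_rel_eq (TensorA f a w)) linearB.
Qed.

Lemma fund_cond_perm_corr (p : {perm E}) : fund_cond (perm_corr p) 1%g p.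
Proof.
apply/fund_condP; split=> [e|x y /imsetP[e _ [/perm_inj-> ->]]]; last exact: lexx.
by apply/imsetP; exists e.
Qed.

Lemma fund_class_eq S S' : (forall rho, fund_hit rho S = fund_hit rho S') ->
  fund_class S = fund_class S'.
Proof.
move=> hitE; apply/eqP; rewrite -subr_eq0; apply/eqP.
have := fund_class_eq0 (fun b : bool => if b then 1 else -1)
                       (fun b : bool => if b then S else S').
rewrite big_bool /= scale1r scaleN1r => -[_]; apply=> rho.
by rewrite big_bool /= hitE mul1r mulN1r subrr.
Qed.

(** Each basis element is a permutation correspondence acting on [f_R], so [tensA] moves it to the
    left factor and leaves [f_R] on the right. *)
Lemma fund_class_gen (v : fund_functor k E X) :
  exists c : {set X * E} -> k, v = \sum_S c S *: fund_class S.
Proof.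
pose gen (u : fund_functor k E X) :=
  exists c : {set X * E} -> k, u = \sum_S c S *: fund_class S.
have gen0 : gen 0.
  by exists (fun=> 0); rewrite big1 // => S _; rewrite scale0r.
have genD a u u' : gen u -> gen u' -> gen (a *: u + u').
  move=> [c ->] [c' ->]; exists (fun S => a * c S + c' S).
  rewrite scaler_sumr -big_split; apply: eq_bigr => S _.
  by rewrite scalerDl scalerA.
pose pi2 f w : fund_functor k E X := quotmod_pi (@Jpred k E W X) (tens f w).
suff gen_tens f w : gen (pi2 f w).
  rewrite -/(gen v) -[v]quotmod_reprK -[generic_quotient.repr v]quotmod_reprK.
  elim/freeg_lin_ind: (generic_quotient.repr _) => [|a [f w] D IH].
    by rewrite !linear0.
  rewrite !linearP; apply: genD => //; exact: gen_tens.
elim/freeg_lin_ind: w f => [|a p w IH] f.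
  by rewrite /pi2 -[0](scale0r (fund_basis k 1%g)) -tensA /kcomp fglift2E
    -(scale0r (0 : kcorr k X E)) tensZl scale0r linear0.
have -> : pi2 f (a *: << p >> + w) =
    pi2 (kcomp f (a *: << perm_corr p >>)) (fund_basis k 1%g) + pi2 f w.
  rewrite /pi2 tensDr tensA linearD; congr (quotmod_pi _ (tens _ _) + _).
  rewrite kcorr_alg_scaleE /fund_scale fglift2Zl /fund_basis fglift2UU.
  by rewrite (fund_actE (fund_cond_perm_corr p)) mul1g.
rewrite -[X in X + _]scale1r; apply: (genD 1) => //.
move: (kcomp _ _); elim/freeg_lin_ind => [|b S g IHg].
  by rewrite /pi2 -(scale0r (0 : kcorr k X E)) tensZl scale0r linear0.
rewrite /pi2 tensDl tensZl linearP; apply: genD => //.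
exists (fun S' => (S' == S)%:R); rewrite (bigD1 S) //= eqxx scale1r.
by rewrite big1 ?addr0 // => S' /negPf->; rewrite scale0r.
Qed.

End FundFunctor.

(** * The kernel and the image of Theta *)

Section ThetaCovers.
Context (k : comNzRingType) (dE dT : Order.disp_t) (E : finPOrderType dE).
Context (T : finTBLatticeType dT) (iota : E -> T) (hE : is_Irr iota) (X : finType).
Implicit Types (phi xi : {ffun X -> T}) (U : {set X}) (rho : {set E^d * X}).

Let iota_le x y : (iota x <= iota y)%O = (x <= y)%O.
Proof. exact: (proj1 hE). Qed.

Let iota_inj : injective iota.
Proof. by move=> x y xy; apply/le_anti; rewrite -!iota_le xy lexx. Qed.

Lemma iota_irr e : iota e \in irr T.
Proof. by rewrite -(proj2 hE) imset_f. Qed.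

Lemma irr_iota t : t \in irr T -> exists e, t = iota e.
Proof. by rewrite -(proj2 hE) => /imsetP[e _ ->]; exists e. Qed.

Definition corr_fiber rho x : {set T} := [set iota e | e in E & (e, x) \in rho].

Definition corr_meet rho : {ffun X -> T} :=
  [ffun x => \meet_(a in corr_fiber rho x) a]%O.

Lemma corr_fiberE rho x e : (iota e \in corr_fiber rho x) = ((e, x) \in rho).
Proof.
apply/imsetP/idP => [[f + /iota_inj->]|ex]; first by rewrite inE.
by exists e; rewrite ?inE.
Qed.

(** Containment in the opposite order says that [phi] lies below the meets. If [e] is hit at [x],
    then [iota e <= phi x <= corr_meet rho x <= iota e], so the meet is [iota e] and lies in the
    fibre. *)
Lemma fund_hit_Gamma rho phi : fund_hit rho (Gamma iota phi) =
  covers [set x | corr_meet rho x \in corr_fiber rho x] (corr_meet rho) phi.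
Proof.
apply/fund_hitP/coversP => -[hit le_hit]; split.
- move=> x; rewrite ffunE; apply/meetsP => _ /imsetP[e + ->]; rewrite inE => ex.
  apply: irr_le => _ /irr_iota[f ->] fx; rewrite iota_le.
  by apply: (le_hit e x f); rewrite ?inE.
- move=> _ /irr_iota[e ->]; have [x ex] := hit e; rewrite inE /= => ephi.
  have meet_phi : (phi x <= corr_meet rho x)%O.
    rewrite ffunE; apply/meetsP => _ /imsetP[f + ->]; rewrite inE => fx.
    apply: irr_le => _ /irr_iota[g ->] gx; rewrite iota_le.
    by apply: (le_hit f x g); rewrite ?inE.
  have meet_e : (corr_meet rho x <= iota e)%O.
    by rewrite ffunE; apply: meets_inf; rewrite corr_fiberE.
  have meetE : corr_meet rho x = iota e.
    by apply/le_anti; rewrite meet_e (le_trans ephi meet_phi).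
  exists x; first by rewrite inE meetE corr_fiberE.
  by split=> //; apply/le_anti; rewrite ephi -meetE meet_phi.
- move=> e; have [x + [phix xix]] := le_hit _ (iota_irr e).
  by rewrite inE xix corr_fiberE => ex; exists x; rewrite // inE /= phix.
move=> e x f ex; rewrite inE /= => fx; rewrite leEdual -iota_le.
apply: le_trans fx (le_trans (hit x) _).
by rewrite ffunE; apply: meets_inf; rewrite corr_fiberE.
Qed.

Lemma covers_fund_hit U xi :
  (forall x, x \in U -> xi x \in irr T) ->
  (forall x, x \notin U -> lat_sigma (xi x) = xi x) ->
  exists rho, forall phi, fund_hit rho (Gamma iota phi) = covers U xi phi.
Proof.
move=> xiU xiS.
(* A covering position gets the fibre consisting of [xi x] alone; a plain one gets all irreducibles
   strictly above [xi x], whose meet is [lat_sigma (xi x)], that is [xi x], and not in the fibre. *)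
exists [set p : E^d * X | if p.2 \in U then iota p.1 == xi p.2
                          else (xi p.2 < iota p.1)%O] => phi.
set rho := [set _ | _]; rewrite fund_hit_Gamma.
have fibU x : x \in U -> corr_fiber rho x = [set xi x].
  move=> xU; have [e xie] := irr_iota (xiU x xU).
  apply/setP => t; rewrite inE xie; apply/idP/eqP => [/imsetP[f + ->]|->].
    by rewrite !inE /= xU xie => /eqP.
  by rewrite corr_fiberE inE /= xU xie.
have fibS x : x \notin U -> corr_fiber rho x = [set e in irr T | (xi x < e)%O].
  move=> xU; apply/setP => t; apply/imsetP/setIdP => [[f + ->]|[/irr_iota[f ->]]].
    by rewrite !inE /= (negPf xU) -[irreducible _]in_set iota_irr.
  by move=> xf; exists f; rewrite // !inE /= (negPf xU).
have meetE x : corr_meet rho x = xi x.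
  rewrite ffunE; have [xU|xU] := boolP (x \in U); first by rewrite fibU // big_set1.
  rewrite fibS // -[RHS]xiS //; apply: eq_bigl => e; by rewrite inE.
have -> : corr_meet rho = xi by apply/ffunP.
congr (covers _ _ _); apply/setP => x; rewrite in_set.
have [xU|xU] := boolP (x \in U); first by rewrite fibU // set11.
by rewrite fibS // !inE ltxx andbF.
Qed.

Lemma Theta_class phi : Theta k iota << phi >> = fund_class k (Gamma iota phi).
Proof. exact: fgliftU. Qed.

(** Correspondences realise exactly the pairs with irreducible covering values and sigma-fixed plain
    values; [cover_null_Gset] then exchanges the plain values. *)
Lemma Theta_eq0 (c : {ffun X -> T} -> k) :
  \sum_phi c phi *: Theta k iota << phi >> = 0 <-> cover_null c (Gset T :\: irr T).
Proof.
under eq_bigr => phi _ do rewrite Theta_class.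
rewrite -cover_null_Gset; split=> [/fund_class_eq0 hit0|null].
  move=> U xi xiU xiS; have [|rho rhoE] := covers_fund_hit xiU.
    by move=> x /xiS; rewrite inE => /eqP.
  by rewrite -[RHS](hit0 rho); apply: eq_bigr => phi _; rewrite rhoE.
apply/fund_class_eq0 => rho; under eq_bigr => phi _ do rewrite fund_hit_Gamma.
apply: null => x; rewrite inE.
  by rewrite !ffunE => /imsetP[e _ ->]; apply: iota_irr.
rewrite inE ffunE => meetNA; apply/eqP/meet_notin_sigma_fix => //.
by apply/subsetP => _ /imsetP[e _ ->]; apply: iota_irr.
Qed.

Definition corr_join (S : {set X * E^d}) : {ffun X -> T} :=
  [ffun x => \join_(e | (x, e) \in S) iota e]%O.

(** [S] may be smaller than [Gamma] of its joins, yet no evaluation separates them; this yields the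
    surjectivity of [Theta]. *)
Lemma fund_hit_corr_join rho (S : {set X * E^d}) :
  fund_hit rho S = fund_hit rho (Gamma iota (corr_join S)).
Proof.
have SG x e : (x, e) \in S -> (x, e) \in Gamma iota (corr_join S).
  by move=> xe; rewrite inE ffunE /=; apply: (joins_sup (fun e : E => iota e)).
have le_join e x : (forall f, (x, f) \in S -> (f <= e :> E)%O) ->
    (corr_join S x <= iota e)%O.
  by move=> xe; rewrite ffunE; apply/joinsP => f /xe; rewrite iota_le.
apply/fund_hitP/fund_hitP => -[hit le_hit]; split.
- by move=> e; have [x ex xe] := hit e; exists x => //; apply: SG.
- move=> e x f ex; rewrite inE /= => xf; rewrite leEdual -iota_le.
  by apply: le_trans xf (le_join _ _ _) => g; apply: le_hit.
- move=> e; have [x ex xe] := hit e; exists x => //.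
  (* The join at [x] is at most [iota e] by [le_hit] and at least [iota e] by [xe]; an irreducible
     equal to a join is one of its terms. *)
  have : iota e \in [set iota f | f in E & (x, f) \in S].
    apply: irr_join_mem; first exact: iota_irr.
    apply/le_anti/andP; split; last first.
      apply/joinsP => _ /imsetP[f + ->]; rewrite inE => /SG xf.
      by rewrite iota_le; apply: le_hit xf.
    move: xe; rewrite inE ffunE /= => /le_trans; apply.
    by apply/joinsP => f xf; apply: (joins_sup id); apply: imset_f; rewrite inE.
  by case/imsetP => f + /iota_inj ->; rewrite inE.
by move=> e x f ex /SG; apply: le_hit.
Qed.

Lemma Theta_gen (v : fund_functor k E^d X) :
  exists c : {ffun X -> T} -> k, v = \sum_phi c phi *: Theta k iota << phi >>.
Proof.
have [c ->] := fund_class_gen v.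
exists (fun phi => \sum_(S | corr_join S == phi) c S).
rewrite (partition_big corr_join predT) //=; apply: eq_bigr => phi _.
rewrite scaler_suml; apply: eq_bigr => S /eqP <-; rewrite Theta_class.
by congr (_ *: _); apply: fund_class_eq => rho; apply: fund_hit_corr_join.
Qed.

End ThetaCovers.

(** * The pairing matrix on B_X *)

Section BasisMaps.
Context (k : comNzRingType) (d : Order.disp_t) (T : finTBLatticeType d).
Context (X : finType).
Implicit Types (phi psi xi : {ffun X -> T}).

Definition irr_points psi : {set X} := [set x | psi x \in irr T].

Lemma mem_irr_points psi x : (x \in irr_points psi) = (psi x \in irr T).
Proof. exact: in_set. Qed.

Definition basis_mx phi psi : k := (covers (irr_points psi) psi phi)%:R.

Definition map_height phi : nat := \sum_x #|[set t | (t <= phi x)%O]|.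

Lemma BsetP psi : reflect
  ((forall e, e \in irr T -> exists x, psi x = e) /\ forall x, psi x \in Gset T)
  (psi \in Bset T X).
Proof.
rewrite inE; apply: (iffP andP) => -[irr_psi psiG]; split.
- by move=> e /(subsetP irr_psi)/imsetP[x _ ->]; exists x.
- by move=> x; apply: (subsetP psiG); apply: imset_f.
- by apply/subsetP => e /irr_psi[x <-]; apply: imset_f.
by apply/subsetP => _ /imsetP[x _ ->].
Qed.

Lemma basis_mx1 psi : psi \in Bset T X -> basis_mx psi psi = 1.
Proof.
move=> /BsetP[irr_psi _]; rewrite /basis_mx [covers _ _ _](_ : _ = true) //.
apply/coversP; split=> // e eI; have [x psix] := irr_psi e eI.
by exists x; rewrite // mem_irr_points psix.
Qed.

Lemma map_height_lt phi psi : (forall x, phi x <= psi x)%O -> phi != psi ->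
  (map_height phi < map_height psi)%N.
Proof.
move=> le_phi; have le_card x :
    (#|[set t | (t <= phi x)%O]| <= #|[set t | (t <= psi x)%O]|)%N.
  by apply/subset_leq_card/subsetP => t; rewrite !inE => /le_trans; apply.
move=> /eqP/ffunP neq; have [x neqx] : exists x, phi x != psi x.
  by apply/existsP; apply: contra_notT neq => /existsPn eq x; apply/eqP/negPn/eq.
rewrite /map_height (bigD1 x) //= [ltnRHS](bigD1 x) //= -addSn leq_add ?leq_sum //.
apply/proper_card/properP; split.
  by apply/subsetP => t; rewrite !inE => /le_trans; apply.
exists (psi x); rewrite !inE ?lexx //; apply: contraNN neqx => psi_phi.
by rewrite eq_le le_phi.
Qed.

Lemma basis_mx0 phi psi : phi != psi -> (map_height psi <= map_height phi)%N ->
  basis_mx phi psi = 0.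
Proof.
move=> neq le_h; rewrite /basis_mx; case: coversP => // -[le_phi _].
by move: le_h; rewrite leqNgt map_height_lt.
Qed.

(** With plain values outside [irr T], the covering set is determined by [xi]. If [xi] is not in
    B_X, it misses an irreducible, so no map is covered and the condition is void. *)
Lemma cover_null_Bset (c : {ffun X -> T} -> k) :
  cover_null c (Gset T :\: irr T) <->
  {in Bset T X, forall psi, \sum_phi c phi * basis_mx phi psi = 0}.
Proof.
split=> [null psi /BsetP[_ psiG]|null U xi xiU xiG].
  apply: null => x; first by rewrite mem_irr_points.
  by rewrite in_setD psiG andbT mem_irr_points.
have {xiU} UE : U = irr_points xi.
  apply/setP => x; rewrite mem_irr_points; apply/idP/idP => [/xiU//|xI].
  by apply: contraTT xI => /xiG; rewrite in_setD => /andP[].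
rewrite {U}UE in xiG *; have [xiB|xiNB] := boolP (xi \in Bset T X); first exact: null.
apply: big1 => phi _; case: coversP => [[_ cov]|]; last by rewrite mulr0.
case/BsetP: xiNB; split=> [e /cov[x _ [_ <-]]|x]; first by exists x.
have [xI|xNI] := boolP (xi x \in irr T); first exact: (subsetP (irr_subset_Gset T)).
by have := xiG x; rewrite in_setD mem_irr_points => /(_ xNI)/andP[].
Qed.

End BasisMaps.

(** * From the pairing matrix to the basis and the rank *)

Lemma basis_injective (k : comNzRingType) (V : lmodType k) (I : finType)
  (B : {set I}) (b : I -> V) : is_basis B b -> {in B &, injective b}.
Proof.
move=> [_ indep] i j iB jB bij; apply/eqP; apply: contraT => ij.
(* Equal images would satisfy a relation with coefficients 1 and -1, forcing [1 = 0] in [k]. *)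
have := indep (fun l => (l == i)%:R - (l == j)%:R) _ i iB.
rewrite eqxx (negPf ij) subr0 => /(_ _)/eqP; rewrite oner_eq0; apply.
have ji : j != i by rewrite eq_sym.
rewrite (bigD1 i) // (bigD1 j) ?jB //= !eqxx (negPf ij) (negPf ji).
rewrite subr0 sub0r scale1r scaleN1r bij addrA subrr add0r big1 // => l.
by case/andP=> /andP[_ /negPf->] /negPf->; rewrite subrr scale0r.
Qed.

Lemma basis_free_of_rank (k : comNzRingType) (V : lmodType k) (I : finType)
  (B : {set I}) (b : I -> V) : is_basis B b -> free_of_rank V #|B|.
Proof.
move=> [gen indep]; exists (fun i => b (enum_val i)); split=> [v|c c0 i _].
  have [c ->] := gen v; exists (fun i => c (enum_val i)).
  by rewrite big_enum_val; apply: eq_bigl => i; rewrite inE.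
pose c' x := if [pick i : 'I_#|B| | enum_val i == x] is Some i then c i else 0.
have c'E j : c' (enum_val j) = c j.
  rewrite /c'; case: pickP => [l /eqP/enum_val_inj->//|/(_ j)].
  by rewrite eqxx.
rewrite -c'E; apply: indep; last exact: enum_valP.
by rewrite big_enum_val -[RHS]c0; apply: eq_big => j; rewrite ?inE ?c'E.
Qed.

(** Vanishing under [Theta] is tested by the columns in B_X, so generation is solvability, and
    independence is injectivity, of the unitriangular system on B_X. *)
Lemma Theta_basis (k : comNzRingType) (dE dT : Order.disp_t)
    (E : finPOrderType dE) (T : finTBLatticeType dT) (iota : E -> T)
    (hE : is_Irr iota) (X : finType) :
  is_basis (Bset T X) (fun phi : {ffun X -> T} => Theta k iota << phi >>).
Proof.
pose M : {ffun X -> T} -> {ffun X -> T} -> k := @basis_mx k _ T X.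
have M1 psi : psi \in Bset T X -> M psi psi = 1 by apply: basis_mx1.
have M0 : {in Bset T X &, forall phi psi, phi != psi ->
    (map_height psi <= map_height phi)%N -> M phi psi = 0}.
  by move=> phi psi _ _; apply: basis_mx0.
split=> [v|c c0].
  have [c ->] := Theta_gen hE v.
  have [a aP] := triangular_solve M1 M0 (fun psi => \sum_phi c phi * M phi psi).
  exists a; apply/eqP; rewrite -subr_eq0 [X in _ - X]big_mkcond -sumrB; apply/eqP.
  (* [a] was chosen with the same pairings as [c], so this difference lies in the kernel of
     [Theta]. *)
  pose c' phi := c phi - if phi \in Bset T X then a phi else 0.
  transitivity (\sum_phi c' phi *: Theta k iota << phi >>).
    apply: eq_bigr => phi _; rewrite scalerBl; case: ifP => // _.
    by rewrite scale0r.
  apply/(Theta_eq0 hE)/cover_null_Bset => psi psiB.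
  under eq_bigr => phi _ do rewrite mulrBl.
  rewrite sumrB -aP // [X in X - _]big_mkcond -sumrB big1 // => phi _.
  by case: ifP => _; rewrite ?mul0r subrr.
apply: (triangular_inj M1 M0) => psi psiB.
pose c' phi := if phi \in Bset T X then c phi else 0.
have c'0 : \sum_phi c' phi *: Theta k iota << phi >> = 0.
  rewrite -[RHS]c0 [RHS]big_mkcond; apply: eq_bigr => phi _.
  by rewrite /c'; case: ifP => // _; rewrite scale0r.
move/(Theta_eq0 hE)/cover_null_Bset/(_ psi psiB): c'0 => c'0; rewrite -[RHS]c'0.
rewrite [LHS]big_mkcond; apply: eq_bigr => phi _.
by rewrite /c'; case: ifP => // _; rewrite mul0r.
Qed.

Theorem theorem5p6 (k : comNzRingType) (dE dT : Order.disp_t)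
    (E : finPOrderType dE) (T : finTBLatticeType dT) (iota : E -> T)
    (hE : is_Irr iota) (X : finType) :
  ({in Bset T X &,
      injective (fun phi : {ffun X -> T} => Theta k iota << phi >>)} /\
   is_basis (Bset T X) (fun phi : {ffun X -> T} => Theta k iota << phi >>)) /\
  (free_of_rank (fund_functor k E^d X) #|Bset T X| /\
   (#|Bset T X|%:Z =
     \sum_(0 <= i < #|E|.+1)
       (-1) ^+ i * 'C(#|E|, i)%:Z * (#|Gset T|%:Z - i%:Z) ^+ #|X|)).
Proof.
have basisB := Theta_basis k hE X; split; split=> //.
- exact: basis_injective.
- exact: basis_free_of_rank basisB.
have -> : #|E| = #|irr T|.
  rewrite -(proj2 hE) card_imset // => x y xy; apply/le_anti.
  by rewrite -!(proj1 hE) xy lexx.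
exact: card_maps_between (irr_subset_Gset T).
Qed.
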